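(* Let $\mathbb{A}$ be a countable $\omega$-categorical homogeneous arsfacere relational structure with no algebraicity, and let $S$ be a monoid (under composition of functions) such that $\operatorname{Emb}(\mathbb{A}) \leq S \leq \operatorname{End}(\mathbb{A})$. Then the Zariski topology on $S$ and the pointwise topology on $S$ coincide.
   Context: Functions are written on the right of their arguments and composed from left to right. Relational structures have relations only (no constants or operations). $\operatorname{End}(\mathbb{A})$, $\operatorname{Emb}(\mathbb{A})$, $\operatorname{Aut}(\mathbb{A})$ denote the monoids of endomorphisms, of self-embeddings (injective maps preserving and reflecting all relations), and of automorphisms of $\mathbb{A}$; $\leq$ between monoids means ''is a submonoid of''. $A$ denotes the domain of $\mathbb{A}$. Homogeneous: every isomorphism between finite induced substructures of $\mathbb{A}$ extends to an automorphism of $\mathbb{A}$. $\omega$-categorical: the first-order theory of $\mathbb{A}$ has a unique countably infinite model up to isomorphism. An $\omega$-categorical structure $\mathbb{A}$ has no algebraicity if for every finite $F\subseteq A$ every orbit on $A\setminus F$ of the pointwise stabiliser $\operatorname{Aut}(\mathbb{A})_F$ of $F$ in $\operatorname{Aut}(\mathbb{A})$ is infinite. A relational structure $\mathbb{A}$ is arsfacere if there are $n\in\mathbb{N}$ and an $n$-ary relation symbol $E$ in the signature of $\mathbb{A}$ such that: (i) $(x,\ldots,x)\notin E^{\mathbb{A}}$ for all $x\in A$; (ii) if $x\in A$ and $F_1,\ldots,F_n\subseteq A$ are finite with $F_i\cap F_j=\{x\}$ for all $i\neq j$ in $\{1,\ldots,n\}$, then there is an injection $f\colon\bigcup_{i=1}^n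 F_i\to A$ such that $f{\restriction_{F_i}}$ is an isomorphism between induced substructures of $\mathbb{A}$ for each $i\in\{1,\ldots,n\}$, and for every $(x_1,\ldots,x_n)\in (F_1\setminus\{x\})\times\cdots\times(F_n\setminus\{x\})$ some permutation of the tuple $((x_1)f,\ldots,(x_n)f)$ is in $E^{\mathbb{A}}$. The Zariski topology on a monoid $S$ is the topology with subbasis consisting of the sets $\{s\in S : (s)\phi_1\neq (s)\phi_2\}$, where $\phi_1,\phi_2\colon S\to S$ are any functions of the form $(s)\phi_1=t_1st_2s\cdots t_{k-1}st_k$ and $(s)\phi_2=u_1su_2s\cdots u_{l-1}su_l$ for some $k,l\geq 1$ and fixed $t_1,\ldots,t_k,u_1,\ldots,u_l\in S$. The pointwise topology on a set $S$ of functions from $A$ to $A$ is the topology with subbasis consisting of the sets $\{f\in S : (x)f=y\}$ for $x,y\in A$.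
   Formalization: The signature of the structure is assumed countable, the usual convention for ω-categoricity; without it the claim fails, e.g. for the rational Urysohn space equipped with all isometry-invariant relations. *)

(* Defs.v *)
From HB Require Import structures.
From mathcomp Require Import all_boot perm.
From mathcomp Require Import boolp classical_sets functions cardinality.
From mathcomp Require Import topology.

Set Implicit Arguments.
Unset Strict Implicit.
Unset Printing Implicit Defensive.

Local Open Scope classical_set_scope.

Record signature := Signature {
  symbol :> Type;
  arity : symbol -> nat
}.

Record structure (L : signature) := Structure {
  dom :> Type;
  rel_of : forall R : L, ('I_(arity R) -> dom) -> Prop
}.

Arguments rel_of {L} s R v.

Section Structures.
Context {L : signature}.

(* [f] restricts to an isomorphism from the substructure of [A] induced on [F]
   onto the substructure of [B] induced on [f @` F]; values of [f] outside [F]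
   are irrelevant. *)
Definition isomorphism_on (A B : structure L) (F : set A) (f : A -> B) : Prop :=
  {in F &, injective f} /\
  forall (R : L) (v : 'I_(arity R) -> A), (forall i, F (v i)) ->
    (rel_of A R v <-> rel_of B R (f \o v)).

Definition endomorphism (A : structure L) (f : A -> A) : Prop :=
  forall (R : L) (v : 'I_(arity R) -> A), rel_of A R v -> rel_of A R (f \o v).

Definition embedding (A B : structure L) (f : A -> B) : Prop :=
  injective f /\
  forall (R : L) (v : 'I_(arity R) -> A), rel_of A R v <-> rel_of B R (f \o v).

Definition isomorphism (A B : structure L) (f : A -> B) : Prop :=
  bijective f /\
  forall (R : L) (v : 'I_(arity R) -> A), rel_of A R v <-> rel_of B R (f \o v).

Definition isomorphic (A B : structure L) : Prop :=
  exists f : A -> B, isomorphism f.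

Definition End (A : structure L) : set (A -> A) := [set f | endomorphism f].
Definition Emb (A : structure L) : set (A -> A) := [set f | embedding f].
Definition Aut (A : structure L) : set (A -> A) := [set f | isomorphism f].

Arguments End A : clear implicits.
Arguments Emb A : clear implicits.
Arguments Aut A : clear implicits.

(* An isomorphism between finite induced substructures is given by its domain
   [F] and a total function [f], of which only the values on [F] matter. *)
Definition homogeneous (A : structure L) : Prop :=
  forall (F : set A) (f : A -> A), finite_set F -> isomorphism_on F f ->
    exists2 g, Aut A g & forall x, F x -> g x = f x.

Definition pointwise_stabiliser (A : structure L) (F : set A) : set (A -> A) :=
  [set g | Aut A g /\ forall x, F x -> g x = x].

Definition no_algebraicity (A : structure L) : Prop :=
  forall F : set A, finite_set F -> forall x, ~ F x ->
    infinite_set [set g x | g in pointwise_stabiliser F].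

(* As in [homogeneous], [f] stands for its restriction to [\bigcup_i F i]. *)
Definition arsfacere (A : structure L) : Prop :=
  exists E : L, let n := arity E in
    (forall x : A, ~ rel_of A E (fun _ : 'I_n => x)) /\
    forall (x : A) (F : 'I_n -> set A),
      (forall i, finite_set (F i)) ->
      (forall i j, i != j -> F i `&` F j = [set x]) ->
      exists f : A -> A,
        [/\ {in \bigcup_i F i &, injective f},
            forall i, isomorphism_on (F i) f
          & forall y : 'I_n -> A, (forall i, (F i `\ x) (y i)) ->
              exists s : 'S_n, rel_of A E (fun i => f (y (s i)))].

(* Well-scoped first-order formulas with equality: the free variables of a
   [formula n] are among the [i : 'I_n]; [All] binds the variable [ord0] of its
   body, the other variables being shifted by one. *)
Inductive formula : nat -> Type :=
| Bot n : formula n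
| Eq n : 'I_n -> 'I_n -> formula n
| Rel n (R : L) : ('I_(arity R) -> 'I_n) -> formula n
| Imp n : formula n -> formula n -> formula n
| All n : formula n.+1 -> formula n.

Definition scons (T : Type) (x : T) n (e : 'I_n -> T) : 'I_n.+1 -> T :=
  fun i => if unlift ord0 i is Some j then e j else x.

Fixpoint sat (A : structure L) n (phi : formula n) : ('I_n -> A) -> Prop :=
  match phi in formula m return ('I_m -> A) -> Prop with
  | Bot _ => fun=> False
  | Eq _ i j => fun e => e i = e j
  | Rel _ R v => fun e => rel_of A R (e \o v)
  | Imp _ phi psi => fun e => sat phi e -> sat psi e
  | All _ phi => fun e => forall x : A, sat phi (scons x e)
  end.

Definition empty_assignment (T : Type) : 'I_0 -> T :=
  fun i => False_rect T (notF (ltn_ord i)).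

Definition theory (A : structure L) : set (formula 0) :=
  [set phi | sat phi (@empty_assignment A)].

Definition model_of (T : set (formula 0)) (A : structure L) : Prop :=
  T `<=` theory A.

Definition countably_infinite (T : Type) : Prop :=
  countable [set: T] /\ infinite_set [set: T].

(* As usual, this notion is only meant for countable signatures: over the
   uncountable signature of all relations on [nat], [nat] itself satisfies it. *)
Definition omega_categorical (A : structure L) : Prop :=
  (exists B : structure L, model_of (theory A) B /\ countably_infinite B) /\
  forall B C : structure L,
    model_of (theory A) B -> countably_infinite B ->
    model_of (theory A) C -> countably_infinite C ->
    isomorphic B C.

End Structures.

Arguments End {L} A _.
Arguments Emb {L} A _.
Arguments Aut {L} A _.

Record fun_monoid (T : Type) := FunMonoid {
  fun_set : set (T -> T);
  fun_set_id : fun_set id;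
  fun_set_comp : forall f g, fun_set f -> fun_set g -> fun_set (g \o f)
}.

Definition fun_monoid_sort (T : Type) (S : fun_monoid T) : Type :=
  {f : T -> T | fun_set S f}.
Coercion fun_monoid_sort : fun_monoid >-> Sortclass.

Section FunMonoid.
Context {T : Type} (S : fun_monoid T).

HB.instance Definition _ := gen_eqMixin S.
HB.instance Definition _ := gen_choiceMixin S.

(* Functions act on the right: [s * t] is [s] followed by [t]. *)
Definition fm_mul (s t : S) : S :=
  exist _ (sval t \o sval s) (fun_set_comp (svalP s) (svalP t)).
Definition fm_one : S := exist _ id (fun_set_id S).

Lemma fm_mulA : associative fm_mul.
Proof. by move=> s t u; exact: eq_exist. Qed.
Lemma fm_mul1 : left_id fm_one fm_mul.
Proof. by move=> [f Sf]; exact: eq_exist. Qed.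
Lemma fm_mulr1 : right_id fm_one fm_mul.
Proof. by move=> [f Sf]; exact: eq_exist. Qed.

HB.instance Definition _ := isMonoid.Build S fm_mulA fm_mul1 fm_mulr1.

End FunMonoid.

(* [word t [:: t_2; ...; t_k] s] is [t * s * t_2 * s * ... * s * t_k]. *)
Definition word (M : monoidType) (t : M) (ts : seq M) (s : M) : M :=
  foldl (fun acc t' => acc * s * t')%g t ts.

Definition zariski_subbasis (M : monoidType) : set (set M) :=
  [set U | exists (t u : M) (ts us : seq M),
     U = [set s | word t ts s <> word u us s]].

Definition zariski (M : monoidType) : Type := M.
HB.instance Definition _ (M : monoidType) := Choice.on (zariski M).
HB.instance Definition _ (M : monoidType) :=
  isSubBaseTopological.Build (zariski M) (@zariski_subbasis M) id.

Definition pointwise_subbasis (T : Type) (S : fun_monoid T) : set (set S) :=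
  [set U | exists x y : T, U = [set f : S | sval f x = y]].

Definition pointwise (T : Type) (S : fun_monoid T) : Type := S.
HB.instance Definition _ (T : Type) (S : fun_monoid T) :=
  Choice.on (pointwise S).
HB.instance Definition _ (T : Type) (S : fun_monoid T) :=
  isSubBaseTopological.Build (pointwise S) (@pointwise_subbasis T S) id.

(* Main.v *)
(* A basic pointwise-open set {s | x s = y} is a finite intersection of basic
   Zariski-open sets {s | g_i s a <> g_i s b}.  Here a and b are self-embeddings
   that differ exactly at y, so that g_i s a <> g_i s b holds iff y lies in the
   image of g_i s; and the g_i are self-embeddings fixing x such that every
   tuple choosing in the image of each g_i a point other than x is, up to
   permutation, in E.  If y were in the image of each g_i s although x s <> y,
   then the endomorphism s would send a tuple of E to (y, ..., y).

   Homogeneity, the arsfacere property and the absence of algebraicity only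
   provide finite approximations of a, b and the g_i.  Their ultraproduct is a
   family of maps from A to an ultrapower of A whose images lie in a countable
   elementary substructure (Los and Loewenheim-Skolem), which is isomorphic to A
   by omega-categoricity. *)

Require Import Defs.
From mathcomp Require Import all_boot perm.
From mathcomp Require Import boolp classical_sets functions cardinality.
From mathcomp Require Import topology.

Set Implicit Arguments.
Unset Strict Implicit.
Unset Printing Implicit Defensive.

Local Open Scope classical_set_scope.

(** * Countable closures and codes of formulas *)

Lemma countable_sub_range (T : Type) (D : set T) (d : T) :
  countable D -> exists e : nat -> T, D `<=` range e.
Proof.
move=> /countable_injP[f f_inj].
have /choice[e eP] n : exists x, (exists2 y, D y & f y = n) -> D x /\ f x = n.
  have [[y Dy fy]|no] := pselect (exists2 y, D y & f y = n); first by exists y.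
  by exists d => /no.
exists e => y Dy; exists (f y) => //.
have [Dx fx] : D (e (f y)) /\ f (e (f y)) = f y by apply: eP; exists y.
by apply: f_inj; rewrite ?inE.
Qed.

(** Serves to form Skolem hulls, with one operation of its own arity per formula; the closure is
    countable because finite trees labelled by numbers are. *)
Lemma countable_closure (T : Type) (ar : nat -> nat)
    (op : forall i, ('I_(ar i) -> T) -> T) (G0 : set T) (d : T) :
  countable G0 -> exists G : set T, [/\ countable G, G0 `<=` G &
    forall i v, (forall j, G (v j)) -> G (op i v)].
Proof.
move=> /(countable_sub_range d)[e eG0].
(* A tree is a term, with leaves naming elements of [G0]. *)
pose eval := fix eval (t : GenTree.tree nat) : T := match t with
  | GenTree.Leaf n => e n
  (* Absent children count as [d], so that [eval] is total on ill-formed trees. *)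
  | GenTree.Node i ts => op i (fun j => nth d (map eval ts) j)
  end.
exists (range eval); split.
- exact: sub_countable (card_image_le _ _) (countableP _).
- by move=> x /eG0[n _ <-]; exists (GenTree.Leaf n).
move=> i v Gv.
have /choice[t tv] j : exists t, eval t = v j.
  by have [t _ <-] := Gv j; exists t.
exists (GenTree.Node i (map t (enum 'I_(ar i)))) => //=.
congr (op i); apply/funext => j.
by rewrite -map_comp (nth_map j) ?size_enum_ord// nth_ord_enum /= tv.
Qed.

Section FormulaCode.
Context {L : signature} (c : L -> nat).

Fixpoint formula_code n (phi : @formula L n) : GenTree.tree nat :=
  match phi with
  | Bot _ => GenTree.Node 0 [::]
  | Eq _ i j =>
      GenTree.Node 1 [:: GenTree.Leaf (i : nat); GenTree.Leaf (j : nat)]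
  | Rel _ R v => GenTree.Node 2 (GenTree.Leaf (c R) ::
      [seq GenTree.Leaf (v i : nat) | i <- enum 'I_(arity R)])
  | Imp _ phi psi => GenTree.Node 3 [:: formula_code phi; formula_code psi]
  | All _ phi => GenTree.Node 4 [:: formula_code phi]
  end.

Lemma formula_code_inj : injective c -> forall n, injective (@formula_code n).
Proof.
move=> c_inj n phi; elim: phi => {n} [n|n i j|n R v|n a IHa b IHb|n a IHa] psi.
- by case: psi.
- by case: n / psi i j => //= n i j i' j' [/ord_inj-> /ord_inj->].
- case: n / psi v => //= n R' v' v [/c_inj RR']; rewrite -RR' in v' *.
  move=> /eq_in_map vv'; congr (Rel _); apply/funext => i; apply/ord_inj.
  by have [] := vv' i (mem_enum _ _).
- by case: n / psi a b IHa IHb => //= n a' b' a b IHa IHb [/IHa-> /IHb->].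
- by case: n / psi a IHa => //= n a' a IHa [/IHa->].
Qed.

Lemma countable_formula (f : nat -> nat) : injective c ->
  countable [set: {n & @formula L (f n)}].
Proof.
move=> c_inj; apply/countable_injP.
(* [formula_code] forgets the number of variables, hence the first component. *)
exists (fun p : {n & formula (f n)} =>
  choice.pickle (projT1 p, formula_code (projT2 p))).
move=> [n phi] [m psi] _ _ /(pcan_inj choice.pickleK)/= [nm].
by rewrite -nm in psi * => /(formula_code_inj c_inj)->.
Qed.

End FormulaCode.

(** * Ultrapowers: Los and Loewenheim-Skolem *)

Lemma ultra_not (K : Type) (U : set_system K) (P : set K) :
  UltraFilter U -> ~ (\forall k \near U, P k) -> \forall k \near U, ~ P k.
Proof. by move=> /(in_ultra_setVsetC P)[]. Qed.

Section Ultrapower.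
Context {L : signature} (A : structure L) (K : Type) (U : set_system K).
Context {UU : UltraFilter U} (B : set (K -> A)).

(** Replaces a quotient by representatives: [B] is to contain at most one sequence of each class
    modulo [U], which is [B_separated]. *)
Definition ultrapower_sub : structure L :=
  @Structure L {s | B s} (fun R v => \forall k \near U,
    rel_of A R (fun i => sval (v i) k)).

Lemma sval_scons n (s : ultrapower_sub) (e : 'I_n -> ultrapower_sub) k :
  (fun i => sval (scons s e i) k) = scons (sval s k) (fun i => sval (e i) k).
Proof. by apply/funext => i; rewrite /scons; case: unlift. Qed.

Hypothesis B_separated : forall b b' : ultrapower_sub,
  (\forall k \near U, sval b k = sval b' k) -> b = b'.

(** The Tarski-Vaught condition, in terms of counterexamples because [All] is the only
    quantifier. *)
Hypothesis B_witness : forall n (phi : @formula L n.+1)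
    (e : 'I_n -> ultrapower_sub), exists b : ultrapower_sub,
  \forall k \near U, forall x,
    ~ sat phi (scons x (fun i => sval (e i) k)) ->
    ~ sat phi (scons (sval b k) (fun i => sval (e i) k)).

(** Los's theorem by induction on [phi]: implication uses that [U] decides every set, and [All] that
    a counterexample chosen coordinatewise lies in [B] up to [U]. *)
Lemma sat_ultrapower_sub n (phi : formula n) (e : 'I_n -> ultrapower_sub) :
  sat phi e <-> \forall k \near U, sat phi (fun i => sval (e i) k).
Proof.
elim: phi e => {n} [n|n i j|n R v|n a IHa b IHb|n a IHa] e //=.
- by split=> // /filter_ex[].
- by split=> [->|/B_separated//]; exact: filterE.
- rewrite IHa IHb; split=> [ab|]; last by move=> ab a1; exact: filterS2 ab a1.
  have [a1|na] := in_ultra_setVsetC (fun k => sat a (fun i => sval (e i) k)) UU.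
    by apply: filterS (ab a1) => k.
  by apply: filterS na => k.
- split=> [alla|alla b]; last first.
    by apply/IHa; apply: filterS alla => k; rewrite sval_scons; apply.
  have [b bP] := B_witness a e.
  have /IHa ab := alla b; apply: filterS2 bP ab => k bP.
  by rewrite sval_scons => ab x; apply: contrapT => /bP.
Qed.

End Ultrapower.

(** The Skolem hull of [G0] and the constants in the ultrapower is a countably infinite model of the
    theory of [A], hence a copy of [A]; [psi] sends a sequence to its class in this copy. *)
Lemma omega_categorical_ultrapower (L : signature) (A : structure L)
    (K : Type) (U : set_system K) (G0 : set (K -> A)) :
  countable [set: symbol L] -> countable [set: dom A] ->
  infinite_set [set: dom A] -> omega_categorical A ->
  UltraFilter U -> countable G0 ->
  exists psi : (K -> A) -> A,
    (forall s t, G0 s -> G0 t ->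
      psi s = psi t <-> \forall k \near U, s k = t k) /\
    (forall (R : L) (v : 'I_(arity R) -> K -> A), (forall i, G0 (v i)) ->
      rel_of A R (fun i => psi (v i)) <->
      \forall k \near U, rel_of A R (fun i => v i k)).
Proof.
move=> Lc Ac Ainf [_ oc] UU G0c.
have [a0 _] := infinite_setN0 Ainf.
have /countable_injP[c /in2TT c_inj] := Lc.
have [en enP] := countable_sub_range
  (existT _ 0 (Bot 1)) (countable_formula S c_inj).
(* The Skolem function of a formula with parameters: a counterexample for the first variable, or
   some arbitrary point if there is none. *)
have /choice[sk skP] (p : {e : {n & @formula L n.+1} & 'I_(projT1 e) -> A}) :
    exists x, forall x', ~ sat (projT2 (projT1 p)) (scons x' (projT2 p)) ->
      ~ sat (projT2 (projT1 p)) (scons x (projT2 p)).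
  have [[x px]|no] := pselect (exists x,
    ~ sat (projT2 (projT1 p)) (scons x (projT2 p))); first by exists x.
  by exists a0 => x px; case: no; exists x.
(* Distinct constant sequences differ modulo [U], so adding them makes the hull infinite. *)
have G1c : countable (G0 `|` range (@cst K A)).
  rewrite -bigcup2E; apply: bigcup_countable => // -[|[|i]] _ //=.
  exact: sub_countable (card_image_le _ _) Ac.
have [G [Gc G1G Gsk]] := @countable_closure _ _
  (fun i v k => sk (existT _ (en i) (fun j => v j k))) _ (cst a0) G1c.
have Gphi p (v : 'I_(projT1 p) -> K -> A) : (forall j, G (v j)) ->
    G (fun k => sk (existT _ p (fun j => v j k))).
  by have [i _ ep] := enP p I; rewrite -ep in v * => /Gsk.
have /choice[pick pickP] (P : set (K -> A)) : exists s, P !=set0 -> P s.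
  have [[s Ps]|no] := pselect (P !=set0); first by exists s.
  by exists (cst a0) => /no.
(* [rep] chooses representatives in [G] modulo [U]. *)
pose rep s := pick [set t | G t /\ \forall k \near U, t k = s k].
have repP s : G s -> G (rep s) /\ \forall k \near U, rep s k = s k.
  move=> Gs; apply: (pickP [set t | G t /\ \forall k \near U, t k = s k]).
  by exists s; split => //; exact: filterE.
have rep_eq s t : (\forall k \near U, s k = t k) -> rep s = rep t.
  move=> st; congr pick; apply/seteqP.
  by split=> r [Gr rs]; split=> //; apply: filterS2 st rs => k -> ->.
pose B : set (K -> A) := rep @` G.
have BG s : B s -> G s by move=> [t /repP[? _] <-].
have BE (b : ultrapower_sub U B) : rep (sval b) = sval b.
  by case: b => s /= [t Gt <-]; apply: rep_eq; have [] := repP t Gt.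
have B_sep (b b' : ultrapower_sub U B) :
    (\forall k \near U, sval b k = sval b' k) -> b = b'.
  move=> /rep_eq; rewrite !BE; move: b b' => [s Bs] [t Bt] /=.
  exact: eq_exist.
(* [q] is the class map on [G]; elsewhere its value is arbitrary. *)
have /choice[q qP] s : exists b : ultrapower_sub U B, G s ->
    \forall k \near U, sval b k = s k.
  have [Gs|nGs] := pselect (G s); last first.
    have GA : G (cst a0) by apply: G1G; right; exists a0.
    by exists (exist _ (rep (cst a0)) (imageP _ GA)).
  by exists (exist _ (rep s) (imageP _ Gs)) => _; have [] := repP s Gs.
have B_wit n (phi : @formula L n.+1) (e : 'I_n -> ultrapower_sub U B) :
    exists b : ultrapower_sub U B,
    \forall k \near U, forall x,
    ~ sat phi (scons x (fun i => sval (e i) k)) ->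
    ~ sat phi (scons (sval b k) (fun i => sval (e i) k)).
  have /(_ (fun j => BG _ (svalP (e j)))) := @Gphi (existT _ n phi) (sval \o e).
  set t := fun k => _ => /qP qt; exists (q t); apply: filterS qt => k -> x.
  exact: (skP (existT _ (existT _ n phi) (fun j => sval (e j) k))).
have los := sat_ultrapower_sub B_sep B_wit.
have q_eq s t : G s -> G t -> (q s = q t <-> \forall k \near U, s k = t k).
  move=> /qP qs /qP qt; split=> [E|st].
    by rewrite E in qs; apply: filterS2 qs qt => k -> .
  by apply: B_sep; apply: filterS3 qs qt st => k -> -> .
have [h [[h' hK h'K] hrel]] : isomorphic (ultrapower_sub U B) A.
  apply: oc => //.
    move=> phi /= phiA; apply/los; apply: filterE => k.
    rewrite (_ : (fun _ => _) = @empty_assignment A) //.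
    by apply/funext => -[].
  split.
    move: Gc => /countable_injP[f f_inj]; apply/countable_injP.
    exists (f \o sval) => -[s Bs] [t Bt] _ _ /= fst.
    by apply/eq_exist/f_inj; rewrite ?inE//; exact: BG.
  move=> Bfin; apply: Ainf; rewrite -(preimage_setT (q \o cst)).
  apply: finite_preimage => // a a' _ _ /q_eq.
  have GA x : G (cst x) by apply: G1G; right; exists x.
  by move=> /(_ (GA _) (GA _))/filter_ex[].
exists (h \o q); split=> [s t G0s G0t|R v G0v] /=.
  rewrite -q_eq; [|by apply: G1G; left..].
  by split=> [/(can_inj hK)|->].
rewrite -(hrel R (q \o v)) /=.
have qv : \forall k \near U, forall i, sval (q (v i)) k = v i k.
  by apply: filter_forall => i; apply: qP; apply: G1G; left.
by split; apply: filterS2 qv => k qv; congr rel_of;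
  apply/funext => i; rewrite qv.
Qed.

(** * Comparison of the two topologies on a monoid of functions *)

Lemma open_of_subbase (V : topologicalType) (D : set (set V)) (U : set V) :
  D `<=` open ->
  (exists2 D', D' `<=` finI_from D id & \bigcup_(B in D') B = U) -> open U.
Proof.
move=> Do [D' D'D <-]; apply: bigcup_open => B /D'D[X XD <-].
rewrite openE => p Xp; apply: filter_bigI => i iX.
by apply: open_nbhs_nbhs; split; [apply/Do/set_mem/XD|exact: Xp].
Qed.

Lemma pointwise_subbasis_open (T : Type) (S : fun_monoid T) (x y : T) :
  @open (pointwise S) [set f : S | sval f x = y].
Proof.
set U := [set _ | _]; exists [set U]; last exact: bigcup_set1.
by move=> _ ->; apply: (@finI_from1 _ _ _ id); exists x, y.
Qed.

Lemma zariski_subbasis_open (M : monoidType) (t u : M) (ts us : seq M) :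
  @open (zariski M) [set s | word t ts s <> word u us s].
Proof.
set U := [set _ | _]; exists [set U]; last exact: bigcup_set1.
by move=> _ ->; apply: (@finI_from1 _ _ _ id); exists t, u, ts, us.
Qed.

Lemma word_rcons (M : monoidType) (t t' : M) ts s :
  word t (rcons ts t') s = (word t ts s * s * t')%g.
Proof. by rewrite /word -cats1 foldl_cat. Qed.

Lemma fun_monoid_eqP (T : Type) (S : fun_monoid T) (f g : S) :
  (forall x, sval f x = sval g x) -> f = g.
Proof. by move: f g => [f Sf] [g Sg] /= /funext; exact: eq_exist. Qed.

(** Evaluating a word at [x] consults [s] at finitely many points only; each further factor [s] adds
    the point [w] reached so far. *)
Lemma near_word (T : Type) (S : fun_monoid T) (t : S) ts (s : pointwise S) x :
  \forall s' \near s, sval (word t ts s') x = sval (word t ts s) x.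
Proof.
elim/last_ind: ts => [|ts t' IH]; first by near=> s'.
set w := sval (word t ts s) x in IH *.
have sw : \forall s' \near s, sval (s' : S) w = sval (s : S) w.
  by apply: open_nbhs_nbhs; split => //; exact: pointwise_subbasis_open.
apply: filterS2 IH sw => s'; rewrite !word_rcons /= => -> ->.
by rewrite -/w.
Unshelve. all: by end_near.
Qed.

Lemma zariski_sub_pointwise (T : Type) (S : fun_monoid T) :
  @open (zariski S) `<=` @open (pointwise S).
Proof.
move=> U; apply: (@open_of_subbase (pointwise S)) => _ [t [u [ts [us ->]]]].
rewrite openE => s /= neq.
have [x neqx] : exists x, sval (word t ts s) x <> sval (word u us s) x.
  by apply/existsNP => eqx; apply/neq/fun_monoid_eqP.
apply: filterS2 (near_word t ts s x) (near_word u us s x) => s' /= e e' E.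
by apply: neqx; rewrite -e -e' E.
Qed.

(** Isolates what the structure must provide: pairs [a], [b] that detect whether [y] is hit, and
    finitely many [g i] whose images jointly detect the value of [s] at [x]. *)
Lemma pointwise_sub_zariski (T : Type) (S : fun_monoid T) :
  (forall y, exists a b : S,
    (forall z, z <> y -> sval a z = sval b z) /\ sval a y <> sval b y) ->
  (forall x, exists n (g : 'I_n -> S),
    (forall i, exists u, sval (g i) u = x) /\
    forall (s : S) y, sval s x <> y ->
      exists i, forall u, sval s (sval (g i) u) <> y) ->
  @open (pointwise S) `<=` @open (zariski S).
Proof.
move=> split_pt avoid U.
apply: (@open_of_subbase (zariski S)) => _ [x [y ->]].
have [a [b [ab aby]]] := split_pt y.
have [n [g [gx gavoid]]] := avoid x.
have wordE i (s : S) : word (g i) [:: a] s <> word (g i) [:: b] s <->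
    exists u, sval s (sval (g i) u) = y.
  split=> [neq|[u su] E]; last first.
    by apply: aby; rewrite -su; have /(congr1 (fun f : S => sval f u)) := E.
  apply: contrapT => /forallNP/= ny; apply/neq/fun_monoid_eqP => u /=.
  exact: ab.
have -> : [set f : S | sval f x = y] =
    [set s : zariski S | forall i, word (g i) [:: a] s <> word (g i) [:: b] s].
  apply/seteqP; split=> s /=.
    move=> sx i; apply/wordE; have [u gu] := gx i.
    by exists u; rewrite gu.
  move=> h; apply: contrapT => /gavoid[i ni].
  by have /wordE[u] := h i; exact: ni.
rewrite openE => s h; apply: (filter_forall (nbhs_filter s)) => i.
by apply: open_nbhs_nbhs; split;
  [exact: (zariski_subbasis_open (g i) (g i) [:: a] [:: b])|exact: h].
Qed.

(** * Displacing finite sets by automorphisms *)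

Section Automorphisms.
Context {L : signature} (A : structure L).

Lemma pointwise_stabiliser_id (F : set A) : pointwise_stabiliser F id.
Proof. by split=> //; split=> //; exists id. Qed.

Lemma pointwise_stabiliser_comp (F G : set A) (f g : A -> A) :
  pointwise_stabiliser F f -> pointwise_stabiliser G g -> F `<=` G ->
  pointwise_stabiliser F (g \o f).
Proof.
move=> [[f_bij f_rel] fF] [[g_bij g_rel] gG] FG; split; last first.
  by move=> x Fx /=; rewrite fF// gG//; exact: FG.
by split=> [|R v]; [exact: bij_comp|rewrite f_rel g_rel].
Qed.

Hypothesis A_no_algebraicity : no_algebraicity A.

Lemma moved_out (F G : set A) x : finite_set F -> finite_set G -> ~ F x ->
  exists2 f, pointwise_stabiliser F f & ~ G (f x).
Proof.
move=> Ffin Gfin /(A_no_algebraicity Ffin) orbit_inf; apply: contrapT => no.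
apply: orbit_inf; apply: sub_finite_set Gfin => _ [f Ff <-].
by apply: contrapT => nG; apply: no; exists f.
Qed.

Context (c : A -> nat) (c_inj : injective c).

Lemma finite_initial k : finite_set [set a | c a < k].
Proof.
rewrite -[X in finite_set X]/(c @^-1` `I_k).
by apply: finite_preimage => // a b _ _; exact: c_inj.
Qed.

(** Points are moved out of [G] one at a time, in the order of their codes. *)
Lemma displaced_copy (F G : set A) m : finite_set F -> finite_set G ->
  exists2 f, pointwise_stabiliser F f &
    forall b, c b < m -> ~ F b -> ~ G (f b).
Proof.
move=> Ffin Gfin; elim: m => [|m [f Ff fG]].
  by exists id; first exact: pointwise_stabiliser_id.
have [[b cb nFb]|no] := pselect (exists2 b, c b = m & ~ F b); last first.
  exists f => // b; rewrite ltnS leq_eqVlt => /orP[/eqP cb|]; last exact: fG.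
  by move=> nFb; case: no; exists b.
have f_inj : injective f by case: Ff => -[/bij_inj].
(* Fixing the images obtained so far keeps them outside [G] while [f b] is moved. *)
pose F' := F `|` f @` [set a | c a < m].
have F'fin : finite_set F'.
  by rewrite finite_setU; split=> //; apply: finite_image;
    exact: finite_initial.
have nF'fb : ~ F' (f b).
  move=> [Fb|[a /= + /f_inj ab]]; last by rewrite ab cb ltnn.
  by have /f_inj bb := Ff.2 _ Fb; apply: nFb; rewrite -bb.
have [g Fg gG] := moved_out F'fin Gfin nF'fb.
exists (g \o f); first exact: pointwise_stabiliser_comp Ff Fg (@subsetUl _ _ _).
move=> a; rewrite ltnS leq_eqVlt => /orP[/eqP ca|ca] nFa /=.
  by rewrite (c_inj (etrans ca (esym cb))).
by rewrite Fg.2; [exact: fG|right; exists a].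
Qed.

(** Each new copy is displaced, apart from [x], from the finite union of the earlier ones. This
    yields the sets meeting only in [x] that [arsfacere] asks for. *)
Lemma disjoint_copies (x : A) m n : exists f : nat -> A -> A,
  (forall i, pointwise_stabiliser [set x] (f i)) /\
  forall i j a b, i < j -> j < n -> c a < m -> c b < m ->
    f i a = f j b -> b = x.
Proof.
elim: n => [|n [f [fx f_disj]]].
  by exists (fun=> id); split=> [i|//]; exact: pointwise_stabiliser_id.
pose G := \bigcup_(i in `I_n) (f i @` [set a | c a < m]).
have Gfin : finite_set G.
  apply: bigcup_finite => // i _; apply: finite_image; exact: finite_initial.
have [g gx gG] := @displaced_copy [set x] G m (finite_set1 x) Gfin.
exists (fun i => if i < n then f i else g); split=> [i|i j a b ij].
  by case: ifP.
rewrite ltnS leq_eqVlt => /orP[/eqP jn|jn].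
  subst j; rewrite ij ltnn => ca cb E; apply: contrapT => /(gG _ cb); apply.
  by exists i => //; exists a.
by rewrite jn (ltn_trans ij jn); exact: f_disj.
Qed.

End Automorphisms.

(** * Limits of finite approximations *)

Section Limits.
Context {L : signature} (A : structure L).
Hypotheses (L_countable : countable [set: symbol L])
  (A_countable : countable [set: dom A])
  (A_infinite : infinite_set [set: dom A])
  (A_omega_categorical : omega_categorical A).
Context (c : A -> nat).

(** Since [U] refines [\oo], every tuple eventually lies in the domain of the approximations. A
    single [psi] serves all [i], so relations between the images of different [g i] are controlled
    too. *)
Lemma embedding_limit (I : countType) (h : I -> nat -> A -> A) :
  (forall i k, isomorphism_on [set a | c a < k] (h i k)) ->
  exists (U : set_system nat) (g : I -> A -> A),
    [/\ UltraFilter U, \oo `<=` U, forall i, Emb A (g i),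
      forall i j a b, g i a = g j b <-> \forall k \near U, h i k a = h j k b
    & forall (R : L) (i : 'I_(arity R) -> I) (a : 'I_(arity R) -> A),
        rel_of A R (fun l => g (i l) (a l)) <->
        \forall k \near U, rel_of A R (fun l => h (i l) k (a l))].
Proof.
move=> h_iso.
have [U [UU ooU]] := @ultraFilterLemma nat \oo _.
pose G0 := range (fun (p : I * A) k => h p.1 k p.2).
have G0h i a : G0 (fun k => h i k a) by exists (i, a).
have G0c : countable G0.
  apply: sub_countable (card_image_le _ _) _; rewrite -setXTT.
  exact: countableX.
have [psi [psi_eq psi_rel]] := omega_categorical_ultrapower L_countable
  A_countable A_infinite A_omega_categorical UU G0c.
have large n (a : 'I_n -> A) : \forall k \near U, forall l, c (a l) < k.
  by apply: filter_forall => l; apply: ooU; exact: nbhs_infty_gt.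
exists U, (fun i a => psi (fun k => h i k a)); split=> //; first last.
- by move=> R i a; rewrite psi_rel.
- by move=> i j a b; rewrite psi_eq.
move=> i; split=> [a b|R v].
  rewrite psi_eq// => ab; have := large 2 (fun l => if l == ord0 then a else b).
  move=> /(filterI ab)/filter_ex[k [hab lk]]; have [h_inj _] := h_iso i k.
  have := lk ord0; have := lk ord_max => /= cb ca.
  by apply: h_inj hab; rewrite inE.
rewrite (psi_rel R (fun l k => h i k (v l)))//; split.
  move=> Rv; apply: filterS (large _ v) => k lk.
  by have [_ <-] := h_iso i k.
move=> /(filterI (large _ v))/filter_ex[k [lk]].
have [_ h_rel] := h_iso i k.
by rewrite -[X in rel_of _ _ X]/(h i k \o v) -h_rel.
Qed.

Lemma embeddings_differing_at (y : A) : injective c -> no_algebraicity A ->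
  exists a b : A -> A, [/\ Emb A a, Emb A b,
    forall z, z <> y -> a z = b z & a y <> b y].
Proof.
move=> c_inj noalg.
have /choice[q qP] k : exists q,
    pointwise_stabiliser ([set a | c a < k] `\ y) q /\ q y <> y.
  have fin : finite_set ([set a | c a < k] `\ y).
    by apply: sub_finite_set (finite_initial c_inj k) => a [].
  have [|q] := moved_out noalg fin (finite_set1 y) (x := y).
    by case=> _; apply.
  by move=> qF qy; exists q.
(* The constant family [id] also passes to the limit, as the limit of [q] can only be compared with
   another limit. *)
pose h (i : bool) k : A -> A := if i then id else q k.
have h_iso i k : isomorphism_on [set a | c a < k] (h i k).
  rewrite /h; case: i; first by split=> [a b _ _|R v _].
  have [[[q_bij q_rel] _] _] := qP k.
  by split=> [a b _ _|R v _]; [exact: (bij_inj q_bij)|exact: q_rel].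
have [U [g [UU ooU g_emb g_eq _]]] := embedding_limit h_iso.
exists (g true), (g false); split=> // [z zy|].
  apply/g_eq; apply: ooU; apply: filterS (nbhs_infty_gt (c z)) => k czk.
  by rewrite /= (qP k).1.2.
by move=> /g_eq/filter_ex[k] /= /esym; exact: (qP k).2.
Qed.

Lemma arsfacere_embeddings (x : A) : injective c -> homogeneous A ->
  no_algebraicity A -> arsfacere A ->
  exists (E : L) (g : 'I_(arity E) -> A -> A),
    [/\ forall y : A, ~ rel_of A E (fun=> y),
      forall i, Emb A (g i), forall i, g i x = x
    & forall a, (forall i, a i <> x) ->
        exists s : 'S_(arity E), rel_of A E (fun i => g (s i) (a (s i)))].
Proof.
move=> c_inj hom noalg [E [E_irr E_ars]]; exists E.
set n := arity E in E_irr E_ars *.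
have /choice[h hP] k : exists h : 'I_n -> A -> A,
    [/\ forall i, isomorphism_on [set a | c a < k] (h i),
      forall i j, h i x = h j x
    & forall a, (forall i, c (a i) < k /\ a i <> x) ->
        exists s : 'S_n, rel_of A E (fun i => h (s i) (a (s i)))].
  (* Large enough for [x] to lie in every [F i]. *)
  pose m := maxn k (c x).+1.
  have [p [px p_disj]] := disjoint_copies noalg c_inj x m n.
  pose F (i : 'I_n) := p i @` [set a | c a < m].
  have [||f [f_inj f_iso f_E]] := E_ars x F.
  - by move=> i; apply: finite_image; exact: finite_initial.
  - move=> i j; wlog ij : i j / i < j.
      move=> H ij; have : (i < j) || (j < i) by rewrite -neq_ltn.
      by case/orP=> ?; [|rewrite setIC]; apply: H; rewrite // eq_sym.
    move=> _; apply/seteqP; split=> [_ [[a ca <-] [b cb ab]]|_ ->] /=.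
      by rewrite -ab (p_disj _ _ _ _ ij (ltn_ord j) ca cb)// (px j).2.
    by split; exists x; rewrite ?(px _).2//= leq_max ltnSn orbT.
  have pF i a : c a < k -> F i (p i a).
    by move=> ca; exists a => //=; rewrite leq_max ca.
  have p_inj i : injective (p i) by case: (px i) => -[/bij_inj].
  exists (fun i => f \o p i); split.
  - move=> i; have [fi_inj fi_rel] := f_iso i; split.
      move=> a b; rewrite !inE /= => ca cb fab; apply: (p_inj i).
      by apply: fi_inj => //; rewrite inE; exact: pF.
    move=> R v cv; have [[_ pi_rel] _] := px i.
    by rewrite pi_rel fi_rel// => l; exact: (pF _ _ (cv l)).
  - by move=> i j /=; rewrite !(px _).2.
  - move=> a ca; apply: (f_E (fun i => p i (a i))) => i.
    have [cai ax] := ca i; split; first exact: pF.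
    by move=> /= pax; apply: ax; apply: (p_inj i); rewrite pax (px i).2.
have h_iso i k : isomorphism_on [set a | c a < k] (h k i) by have [] := hP k.
have [U [g [UU ooU g_emb g_eq g_rel]]] :=
  embedding_limit (h := fun i k => h k i) h_iso.
(* The [g i] agree at [x] but need not fix it; homogeneity moves the common value back to [x]. In
   arity zero there is nothing to move. *)
have [t [[t_bij t_rel] tx]] : exists t, Aut A t /\ forall i, t (g i x) = x.
  have [[i _]|no] := pselect (exists i : 'I_n, True); last first.
    exists id; split; first by split=> //; exists id.
    by move=> i; case: no; exists i.
  have [|t t_aut tx] := hom [set g i x] (fun=> x) (finite_set1 _).
    split=> [a b|R v vx]; first by rewrite !inE /= => -> ->.
    rewrite (_ : v = g i \o (fun=> x)); last by apply/funext => l; exact: vx.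
    by have [_ <-] := g_emb i.
  exists t; split=> // j; rewrite (_ : g j x = g i x); first exact: tx.
  by apply/g_eq; apply: filterE => k; have [_ + _] := hP k; apply.
exists (fun i => t \o g i); split=> //.
- move=> i; have [gi_inj gi_rel] := g_emb i; split.
    exact: inj_comp (bij_inj t_bij) gi_inj.
  by move=> R v; rewrite gi_rel t_rel.
- move=> a ax; apply: contrapT => /forallNP ns.
  (* There are finitely many permutations, so failure of each one modulo [U] gives a single large
     [k] at which all fail. *)
  have {}ns (s : 'S_n) :
      \forall k \near U, ~ rel_of A E (fun i => h k (s i) (a (s i))).
    apply: ultra_not => /(g_rel _ s (a \o s)).
    by rewrite t_rel; exact: ns.
  have large : \forall k \near U, forall i, c (a i) < k.
    by apply: filter_forall => l; apply: ooU; exact: nbhs_infty_gt.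
  have [k [lk nk]] := filter_ex (filterI large (filter_forall _ ns)).
  have [_ _ /(_ a)[|s]] := hP k; first by move=> i; split.
  exact: nk.
Qed.

End Limits.

Theorem theoremA (L : signature) (A : structure L) (S : fun_monoid A)
    (L_countable : countable [set: symbol L])
    (A_countable : countable [set: dom A])
    (A_omega_categorical : omega_categorical A)
    (A_homogeneous : homogeneous A)
    (A_arsfacere : arsfacere A)
    (A_no_algebraicity : no_algebraicity A)
    (Emb_S : Emb A `<=` fun_set S)
    (S_End : fun_set S `<=` End A) :
  @open (zariski S) = @open (pointwise S) :> set (set S).
Proof.
have /countable_injP[c /in2TT c_inj] := A_countable.
(* The orbit of [x] under the stabiliser of the empty set is already infinite. *)
have A_infinite (x : A) : infinite_set [set: A].
  move=> Afin; apply: (A_no_algebraicity set0 (finite_set0 _) x) => //.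
  exact: sub_finite_set Afin.
apply/seteqP; split; first exact: zariski_sub_pointwise.
apply: pointwise_sub_zariski => [y|x].
  have [a [b [/Emb_S Sa /Emb_S Sb ab aby]]] := embeddings_differing_at
    L_countable A_countable (A_infinite y) A_omega_categorical y c_inj
    A_no_algebraicity.
  by exists (exist _ a Sa), (exist _ b Sb).
have [E [g [E_irr g_emb gx gE]]] := arsfacere_embeddings
  L_countable A_countable (A_infinite x) A_omega_categorical x c_inj
  A_homogeneous A_no_algebraicity A_arsfacere.
exists (arity E), (fun i => exist _ (g i) (Emb_S _ (g_emb i))).
split=> [i|s y sxy]; first by exists x; exact: gx.
apply: contrapT => /forallNP hit.
have /choice[u su] i : exists u, sval s (g i u) = y.
  by have /existsNP[u /contrapT] := hit i; exists u.
(* No [u i] equals [x], because [g i] fixes [x] and [s] does not send [x] to [y]. *)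
have [i|p] := gE u.
  by move=> ux; apply: sxy; rewrite -(su i) ux gx.
move=> /(S_End _ (svalP s)); rewrite (_ : _ \o _ = fun=> y); first exact: E_irr.
by apply/funext => i; exact: su.
Qed.
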